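(* Let $X$ be an infinite Lindelöf real GO-space. Then the following assertions are equivalent: (1) $X$ is Menger. (2) $X$ is totally paracompact. (3) $X$ is totally metacompact.
   Context: A real GO-space (real generalized-ordered space) is a triple $(X,<,\tau)$ where $X\subseteq\mathbb{R}$, $<$ is the usual order of $\mathbb{R}$ restricted to $X$, and $\tau$ is a Hausdorff topology on $X$ generated by some family of intervals of $X$ (possibly degenerate, i.e. singletons are allowed); here intervals of $X$ are order-convex subsets of $X$. One writes $X$ for $(X,<,\tau)$, and topological notions refer to $\tau$. A space is Lindelöf if every open cover has a countable subcover. A space $X$ is totally paracompact (totally metacompact) if every open base of $X$ contains, as a subfamily, a locally finite (respectively point-finite) cover of $X$. A space $X$ is Menger if for every sequence $\mathcal{U}_0,\mathcal{U}_1,\dots$ of open covers of $X$ there are finite sets $\mathcal{F}_0\subseteq\mathcal{U}_0,\mathcal{F}_1\subseteq\mathcal{U}_1,\dots$ such that $\bigcup_{n\in\omega}\mathcal{F}_n$ is a cover of $X$. *)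

(* Defs.v *)
From HB Require Import structures.
From mathcomp Require Import all_boot all_order all_algebra.
From mathcomp Require Import all_classical all_reals topology.

Set Implicit Arguments.
Unset Strict Implicit.
Unset Printing Implicit Defensive.

Import Order.TTheory GRing.Theory Num.Theory.

Local Open Scope classical_set_scope.
Local Open Scope ring_scope.

Section real_GO_space.
Context {R : realType}.

Definition order_convex (X : set R) (I : set X) :=
  forall x y z : X, I x -> I y -> val x <= val z <= val y -> I z.

(* A copy of the type of points of X whose topology is the coarsest one
   containing the members of G, instead of the topology inherited from R
   that is canonical on set_type X. *)
Definition GO_type (X : set R) (G : set (set X)) : Type := set_type X.

HB.instance Definition _ (X : set R) (G : set (set X)) :=
  Choice.on (GO_type G).
HB.instance Definition _ (X : set R) (G : set (set X)) :=
  isSubBaseTopological.Build (GO_type G) G id.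

Definition real_GO_space (X : set R) (G : set (set X)) :=
  (forall I, G I -> order_convex I) /\ hausdorff_space (GO_type G).

End real_GO_space.

Section covering_properties.
Context (T : topologicalType).
Implicit Types U V B : set (set T).

Definition covers U := \bigcup_(A in U) A = [set: T].

Definition open_cover U := U `<=` open /\ covers U.

Definition locally_finite U := forall x : T,
  exists2 O, nbhs x O & finite_set [set A | U A /\ A `&` O !=set0].

Definition point_finite U := forall x : T, finite_set [set A | U A /\ A x].

Definition lindelof := forall U, open_cover U ->
  exists V, [/\ V `<=` U, countable V & covers V].

Definition totally_paracompact := forall B, basis B ->
  exists V, [/\ V `<=` B, locally_finite V & covers V].

Definition totally_metacompact := forall B, basis B ->
  exists V, [/\ V `<=` B, point_finite V & covers V].

Definition menger := forall U : nat -> set (set T),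
  (forall n, open_cover (U n)) ->
  exists F : nat -> set (set T),
    (forall n, F n `<=` U n /\ finite_set (F n)) /\ covers (\bigcup_n F n).

End covering_properties.

(* Main.v *)
Require Import Defs.
From mathcomp Require Import all_boot all_order all_algebra.
From mathcomp Require Import all_classical all_reals topology.

(* Menger implies totally paracompact in every regular space.  In the Menger
   game played along a base, ONE offers open sets [C] shrunk inside an open set
   [A], closure included, such that [A] either lies in the union of the [A]'s
   already played or belongs to the base and misses the [C]'s already played.
   By Hurewicz's theorem some play against this strategy is won by TWO; dropping
   the [A]'s of the first kind from it leaves a locally finite cover.

   Conversely, suppose that the sequence [d] meets every neighbourhood of every
   non-isolated point (for a subset of the line, pick points between rationals).
   Given open covers [U n], the open sets that contain some [d n] and are
   covered by finitely many members of [U n] form a base together with the open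
   singletons, because [O `&` (C `|` D)] is such a set when [C] and [D] in [U n]
   contain the given point and [d n].  In a point-finite subcover each [d n]
   lies in finitely many sets, which gives a finite selection from each [U n];
   the points it misses are isolated, hence countably many in a Lindelof space,
   and one more member of each [U n] takes care of them. *)

Set Implicit Arguments.
Unset Strict Implicit.
Unset Printing Implicit Defensive.

Import Order.TTheory GRing.Theory Num.Theory.

Local Open Scope classical_set_scope.

Section topological_preliminaries.
Context {T : topologicalType}.
Implicit Types (U V : set (set T)) (O : set T).

Lemma coversP U : covers U <-> forall x, exists2 A, U A & A x.
Proof.
by rewrite /covers -subTset; split=> covU x => [|_]; exact: covU.
Qed.

Lemma closure_bigcup_finite (I : choiceType) (D : set I) (F : I -> set T) :
  finite_set D ->
  closure (\bigcup_(i in D) F i) = \bigcup_(i in D) closure (F i).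
Proof.
move=> finD; apply/seteqP; split; last first.
  by move=> x [i Di]; apply: closureS; exact: bigcup_sup.
have /closure_id -> : closed (\bigcup_(i in D) closure (F i)).
  by apply: closed_bigcup => // i _; exact: closed_closure.
by apply: closureS; apply: subset_bigcup => i _; exact: subset_closure.
Qed.

Lemma isolatedT_open (x : T) : isolated [set: T] x <-> open [set x].
Proof.
split=> [[_ [V nV]]|ox].
  by rewrite setIT => VE; rewrite openE => _ ->; rewrite /interior -VE.
split; first exact/mem_set.
by exists [set x]; [exact: open_nbhs_nbhs|rewrite setIT].
Qed.

Lemma isolated_or_limit_point (x : T) :
  isolated [set: T] x \/ limit_point [set: T] x.
Proof.
have := @subset_closure T [set: T] x I.
by rewrite closure_isolated_limit_point.
Qed.

End topological_preliminaries.

Lemma totally_paracompact_metacompact (T : topologicalType) :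
  totally_paracompact T -> totally_metacompact T.
Proof.
move=> tpT B /tpT[V [VB lfV covV]]; exists V; split=> // x.
have [O nO finO] := lfV x; apply: sub_finite_set finO => A [VA Ax].
by split=> //; exists x; split=> //; exact: nbhs_singleton.
Qed.

Lemma menger_lindelof (T : topologicalType) : menger T -> lindelof T.
Proof.
move=> mT U ocU; have [F [FU covF]] := mT (fun=> U) (fun=> ocU).
exists (\bigcup_n F n); split=> //.
  by move=> A [n _]; apply: (FU n).1.
by apply: bigcup_countable => // n _; apply/finite_set_countable/(FU n).2.
Qed.

Lemma lindelof_countable_subfamily (T : topologicalType) (I : Type)
    (D : set I) (f : I -> set T) :
  lindelof T -> D !=set0 -> (forall i, D i -> open (f i)) ->
  (forall x, exists2 i, D i & f i x) ->
  exists2 u : nat -> I, (forall n, D (u n)) & forall x, exists n, f (u n) x.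
Proof.
move=> linT [i0 Di0] openf covf.
have [|V [VD cV /coversP covV]] := linT (f @` D).
  split; first by move=> _ [i Di <-]; exact: openf.
  by apply/coversP => x; have [i Di fx] := covf x; exists (f i) => //; exists i.
have [g gV] : exists g : nat -> set T, set_surj setT V g by exact/pcard_surjP.
have /choice[u uP] n : exists i, D i /\ (V (g n) -> f i = g n).
  by have [/VD[i Di <-]|nV] := pselect (V (g n)); [exists i|exists i0].
exists u => [n|x]; first exact: (uP n).1.
have [C VC Cx] := covV x; have [n _ gnC] := gV C VC.
by exists n; rewrite (uP n).2 gnC.
Qed.

Section menger_game.
Context {T : topologicalType}.

Lemma menger_nondecreasing_covers (V : nat -> nat -> set T) : menger T ->
  (forall n k, open (V n k)) ->
  (forall n, {homo V n : k k' / (k <= k')%N >-> k `<=` k'}) ->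
  (forall n x, exists k, V n k x) ->
  exists g : nat -> nat, forall x, exists n, V n (g n) x.
Proof.
move=> mT openV ndV covV.
have [n|F [FV /coversP covF]] := mT (fun n => range (V n)).
  split; first by move=> _ [k _ <-].
  by apply/coversP => x; have [k Vx] := covV n x; exists (V n k); [exists k|].
have /choice[g gP] n : exists k, forall A, F n A -> A `<=` V n k.
  have [FVn /finite_seqP[s Fs]] := FV n.
  have /choice[i iP] A : exists i, F n A -> A = V n i.
    have [/FVn[i _ <-]|nFA] := pselect (F n A); first by exists i.
    by exists 0%N.
  exists (\max_(A <- s) i A) => A FA; rewrite {1}(iP A FA).
  by apply: ndV; apply: (@leq_bigmax_seq _ _ predT) => //; rewrite Fs in FA.
exists g => x; have [A [n _ FA] Ax] := covF x.
by exists n; exact: gP FA _ Ax.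
Qed.

(* [strategy s] is the cover that ONE plays after TWO has given the answers [s],
   where the answer [k] selects the first [k.+1] sets of a cover. *)
Variable strategy : seq nat -> nat -> set T.
Hypothesis open_strategy : forall s k, open (strategy s k).
Hypothesis strategy_covers : forall s x, exists k, strategy s k x.

Definition answer s k := \bigcup_(i in `I_k.+1) strategy s i.

(* The points that TWO is sure to cover from the history [s] on by giving [n]
   answers at most [k] and then the answer [k].  The first conjunct makes this
   nondecreasing in [k]: any answer above [k] covers these points as well. *)
Fixpoint secured n k (s : seq nat) : set T :=
  answer s k `&`
  (if n is m.+1
   then \bigcap_(j in `I_k.+1) (answer s j `|` secured m k (rcons s j))
   else setT).

Lemma leq_answer s : {homo answer s : k k' / (k <= k')%N >-> k `<=` k'}.
Proof.
by move=> k k' kk'; apply: bigcup_subset => i /= ik; exact: leq_trans ik _.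
Qed.

Lemma open_answer s k : open (answer s k).
Proof. by apply: bigcup_open. Qed.

Lemma open_secured n k s : open (secured n k s).
Proof.
elim: n s => [|n IHn] s; apply: openI; try exact: open_answer.
  exact: openT.
rewrite -closedC setC_bigcap; apply: closed_bigcup => // j _.
by apply/open_closedC/openU => //; exact: open_answer.
Qed.

Lemma leq_secured n s :
  {homo secured n ^~ s : k k' / (k <= k')%N >-> k `<=` k'}.
Proof.
move=> k k' kk'; elim: n s => [|n IHn] s x [sk cov]; split=> //.
- exact: leq_answer sk.
- exact: leq_answer sk.
move=> j /= jk'; have [jk|kj] := leqP j k; last first.
  by left; apply: leq_answer sk; exact: ltnW.
by have [sj|/IHn] := cov j jk; [left|right].
Qed.

Lemma secured_covers n s x : exists k, secured n k s x.
Proof.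
elim: n s => [|n IHn] s; have [k0 sk0] := strategy_covers s x;
  have ans k : (k0 <= k)%N -> answer s k x by exists k0.
  by exists k0; split=> //; exact: ans.
have /choice[f fP] j := IHn (rcons s j).
exists (maxn k0 (\max_(j < k0) f j)); split; first exact/ans/leq_maxl.
move=> j _; have [jk0|k0j] := ltnP j k0; last by left; exact: ans.
right; apply: leq_secured (fP j); apply: leq_trans (leq_maxr _ _).
exact: (leq_bigmax (F := fun j : 'I_k0 => f j) (Ordinal jk0)).
Qed.

Lemma secured_play (h : nat -> nat) n m x :
  {homo h : i j / (i <= j)%N} -> secured n (h (m + n)%N) (mkseq h m) x ->
  exists i, answer (mkseq h i) (h i) x.
Proof.
move=> ndh; elim: n m => [|n IHn] m; first by rewrite addn0 => -[? _]; exists m.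
move=> [_ /(_ (h m))[|?|]]; first by apply: ndh; exact: leq_addr.
  by exists m.
by rewrite -mkseqS -addSnnS; exact: IHn.
Qed.

Theorem menger_game : menger T ->
  exists h : nat -> nat, forall x, exists n, answer (mkseq h n) (h n) x.
Proof.
move=> mT.
have [|n|n x|g gP] :=
  @menger_nondecreasing_covers (fun n k => secured n k [::]) mT.
- by move=> *; exact: open_secured.
- exact: leq_secured.
- exact: secured_covers.
pose h n := (\sum_(i < n.+1) g i)%N.
exists h => x; have [n gnx] := gP x.
apply: (@secured_play h n 0); last first.
  by apply: leq_secured gnx; rewrite add0n /h big_ord_recr leq_addl.
apply: (homo_leq leqnn leq_trans) => i.
by rewrite /h [leqRHS]big_ord_recr leq_addr.
Qed.

End menger_game.

Section shrunk_pairs.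
Context {T : topologicalType}.
Implicit Types p q : set T * set T.

Definition shrunk p := [/\ open p.1, open p.2 & closure p.1 `<=` p.2].

Lemma shrunk0 : shrunk (set0, set0).
Proof. by split=> /=; rewrite ?closure0 //; exact: open0. Qed.

Lemma shrunkU p q : shrunk p -> shrunk q ->
  shrunk (p.1 `|` q.1, p.2 `|` q.2).
Proof.
move=> [op1 op2 clp] [oq1 oq2 clq].
by split=> /=; [exact: openU|exact: openU|rewrite closureU; exact: setUSS].
Qed.

Lemma shrunk_bigcup (I : choiceType) (D : set I) (q : I -> set T * set T) :
  finite_set D -> (forall i, D i -> shrunk (q i)) ->
  shrunk (\bigcup_(i in D) (q i).1, \bigcup_(i in D) (q i).2).
Proof.
move=> finD shq; split=> /=.
- by apply: bigcup_open => i /shq[].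
- by apply: bigcup_open => i /shq[].
- by rewrite closure_bigcup_finite//; apply: subset_bigcup => i /shq[].
Qed.

Lemma regular_shrunk (A : set T) x : regular_space T -> open A -> A x ->
  exists2 C, shrunk (C, A) & C x.
Proof.
move=> regT oA Ax; have /regT[C nC CA] : nbhs x A by exact: open_nbhs_nbhs.
exists C^°; last exact: nC.
split=> //=; first exact: open_interior.
by apply: subset_trans CA; apply: closureS; exact: interior_subset.
Qed.

End shrunk_pairs.

Section game_along_a_basis.
Context {T : topologicalType}.
Variable B : set (set T).
Hypothesis basisB : basis B.
Implicit Types p q : set T * set T.

(* The position [p] is the pair of the unions of the shrunk sets selected so far
   and of the sets in which they are shrunk. *)
Definition valid_move p q :=
  shrunk q /\ (q.2 `<=` p.2 \/ B q.2 /\ q.2 `&` p.1 = set0).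

Lemma exists_valid_move p x : regular_space T -> shrunk p ->
  exists2 q, valid_move p q & q.1 x.
Proof.
move=> regT [_ op2 clp]; have [px|px] := pselect (p.2 x).
  have [C shC Cx] := regular_shrunk regT op2 px.
  by exists (C, p.2) => //; split=> //; left.
have /basisB.2[A [BA Ax] Ap] : nbhs x (~` closure p.1).
  apply: open_nbhs_nbhs; split; first exact/closed_openC/closed_closure.
  by move/clp.
have [C shC Cx] := regular_shrunk regT (basisB.1 _ BA) Ax.
exists (C, A) => //; split=> //; right; split=> //.
apply/disjoints_subset; apply: subset_trans Ap _.
by apply: subsetC; exact: subset_closure.
Qed.

Lemma exists_covering_moves p : regular_space T -> lindelof T -> shrunk p ->
  exists2 e : nat -> set T * set T,
    forall k, valid_move p (e k) & forall x, exists k, (e k).1 x.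
Proof.
move=> regT linT shp.
apply: (@lindelof_countable_subfamily T _ (valid_move p) fst) => //.
- by exists p; split=> //; left.
- by move=> q [[]].
- by move=> x; exact: exists_valid_move.
Qed.

Section play.
Variable e : set T * set T -> nat -> set T * set T.
Hypothesis e_valid : forall p, shrunk p -> forall k, valid_move p (e p k).

Definition next_position p k : set T * set T :=
  (p.1 `|` \bigcup_(i in `I_k.+1) (e p i).1,
   p.2 `|` \bigcup_(i in `I_k.+1) (e p i).2).

Definition reached (s : seq nat) := foldl next_position (set0, set0) s.

Lemma reached_rcons s k : reached (rcons s k) = next_position (reached s) k.
Proof. exact: foldl_rcons. Qed.

Lemma shrunk_reached s : shrunk (reached s).
Proof.
elim/last_ind: s => [|s k IHs]; first exact: shrunk0.
rewrite reached_rcons; apply: (shrunkU IHs (shrunk_bigcup _ _)) => // i _.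
exact: (e_valid IHs i).1.
Qed.

Variable h : nat -> nat.
Let p n := reached (mkseq h n).

Let pS n : p n.+1 = next_position (p n) (h n).
Proof. by rewrite /p mkseqS reached_rcons. Qed.

Definition retained := [set A | exists n i,
  [/\ (i < (h n).+1)%N, A = (e (p n) i).2 & ~ A `<=` (p n).2]].

Lemma retained_sub_basis : retained `<=` B.
Proof.
move=> A [n [i [_ -> nA]]].
by have [_ [//|[]]] := e_valid (shrunk_reached (mkseq h n)) i.
Qed.

Lemma reached_fst_nondecreasing :
  {homo (fun n => (p n).1) : m n / (m <= n)%N >-> m `<=` n}.
Proof.
apply: homo_leq => [A|A1 A2 A3|n]; [by []|exact: subset_trans|].
by rewrite pS; exact: subsetUl.
Qed.

Lemma retained_locally_finite : (forall x, exists n, (p n).1 x) ->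
  locally_finite retained.
Proof.
move=> covp x; have [N pNx] := covp x; exists (p N).1.
  by apply: open_nbhs_nbhs; split=> //; have [] := shrunk_reached (mkseq h N).
apply: (@sub_finite_set _ _ (\bigcup_(n in `I_N)
    [set (e (p n) i).2 | i in `I_(h n).+1])); last first.
  by apply: bigcup_finite => // n _; exact: finite_image.
move=> A [[n [i [ih -> nA]]] [y [Ay py]]].
have [nN|Nn] := ltnP n N; first by exists n => //; exists i.
have [_ [//|[_]]] := e_valid (shrunk_reached (mkseq h n)) i.
by move=> /disjoints_subset/(_ y Ay)[]; exact: reached_fst_nondecreasing py.
Qed.

Lemma retained_covers : (forall x, exists n, (p n).1 x) -> covers retained.
Proof.
move=> covp; apply/coversP => x.
have [N pNx] : exists n, (p n).2 x.
  have [n pnx] := covp x; exists n.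
  by have [_ _] := shrunk_reached (mkseq h n); apply; exact: subset_closure.
elim: N pNx => [//|N IHN].
have [pNx _|pNx] := pselect ((p N).2 x); first exact: IHN.
rewrite pS => -[//|[i ih ex]]; exists (e (p N) i).2 => //.
by exists N, i; split=> // /(_ x ex).
Qed.

End play.
End game_along_a_basis.

Theorem menger_totally_paracompact (T : topologicalType) :
  regular_space T -> menger T -> totally_paracompact T.
Proof.
move=> regT mT B basisB.
have /choice[e eP] (p : set T * set T) : exists e : nat -> set T * set T,
    shrunk p ->
    (forall k, valid_move B p (e k)) /\ forall x, exists k, (e k).1 x.
  have [shp|] := pselect (shrunk p); last by exists (fun=> p).
  have [e ? ?] := exists_covering_moves basisB regT (menger_lindelof mT) shp.
  by exists e.
have e_valid p : shrunk p -> forall k, valid_move B p (e p k) by move=> /eP[].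
have sh_e s := shrunk_reached e_valid s.
have [s k|s|h hP] := @menger_game T (fun s k => (e (reached e s) k).1) _ _ mT.
- by have [[]] := e_valid _ (sh_e s) k.
- exact: (eP _ (sh_e s)).2.
have covh x : exists n, (reached e (mkseq h n)).1 x.
  by have [n hnx] := hP x; exists n.+1; rewrite mkseqS reached_rcons; right.
exists (retained e h); split.
- exact: (retained_sub_basis e_valid).
- exact: (retained_locally_finite e_valid).
- exact: (retained_covers e_valid).
Qed.

Section finite_selections.
Context {T : topologicalType}.

Definition finitely_covered (U : set (set T)) (A : set T) :=
  exists W, [/\ W `<=` U, finite_set W & A `<=` \bigcup_(C in W) C].

Lemma finitely_covered_bigcup (U : set (set T)) (I : Type) (D : set I)
    (f : I -> set T) : finite_set D ->
  (forall i, D i -> finitely_covered U (f i)) ->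
  finitely_covered U (\bigcup_(i in D) f i).
Proof.
move=> finD fcf.
have /choice[w wP] i : exists W, D i ->
    [/\ W `<=` U, finite_set W & f i `<=` \bigcup_(C in W) C].
  by have [/fcf[W]|] := pselect (D i); [exists W|exists set0].
exists (\bigcup_(i in D) w i); split.
- by apply: bigcup_sub => i /wP[].
- by apply: bigcup_finite => // i /wP[].
- move=> x [i Di fx]; have [_ _ /(_ x fx)[C wC Cx]] := wP i Di.
  by exists C => //; exists i.
Qed.

Definition finite_selection (U F : nat -> set (set T)) :=
  forall n, F n `<=` U n /\ finite_set (F n).

Lemma lindelof_isolated_setC_range (O : set T) (x0 : T) :
  lindelof T -> open O -> ~` O `<=` isolated [set: T] ->
  exists u : nat -> T, ~` O `<=` range u.
Proof.
move=> linT oO isoO.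
have [|x _|x|u _ uP] :=
  @lindelof_countable_subfamily T T setT (fun x => O `|` [set x]) linT.
- by exists x0.
- have [Ox|/isoO/isolatedT_open ox] := pselect (O x); last exact: openU.
  by have /setUidPl-> : [set x] `<=` O by move=> _ ->.
- by exists x => //; right.
by exists u => x nOx; have [n [//|->]] := uP x; exists n.
Qed.

Lemma finite_selection_extend (U F : nat -> set (set T)) : lindelof T ->
  (forall n, open_cover (U n)) -> finite_selection U F ->
  ~` (\bigcup_n \bigcup_(C in F n) C) `<=` isolated [set: T] ->
  exists F', finite_selection U F' /\ covers (\bigcup_n F' n).
Proof.
move=> linT ocU selF; set O := (X in ~` X) => isoO.
have FO x : O x -> exists2 A, (\bigcup_n F n) A & A x.
  by move=> [n _ [C FC Cx]]; exists C => //; exists n.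
have [OT|/existsNP[x0 _]] := pselect (forall x, O x).
  by exists F; split=> //; apply/coversP => x; exact/FO/OT.
have oO : open O.
  apply: bigcup_open => n _; apply: bigcup_open => C FC.
  exact/(ocU n).1/(selF n).1.
have [u uO] := lindelof_isolated_setC_range x0 linT oO isoO.
have /choice[C CP] n : exists C, U n C /\ C (u n).
  by have /coversP/(_ (u n))[C UC Cu] := (ocU n).2; exists C.
exists (fun n => F n `|` [set C n]); split=> [n|].
  have [FU finF] := selF n; split; last by rewrite finite_setU.
  by move=> A [/FU//|->]; exact: (CP n).1.
apply/coversP => x; have [/FO[A [n _ FA] Ax]|/uO[n _ unx]] := pselect (O x).
  by exists A => //; exists n => //; left.
exists (C n); last by rewrite -unx; exact: (CP n).2.
by exists n => //; right.
Qed.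

End finite_selections.

Section anchored_basis.
Context {T : topologicalType}.
Variables (d : nat -> T) (U : nat -> set (set T)).

Definition anchored n (A : set T) :=
  [/\ open A, A (d n) & finitely_covered (U n) A].

Definition anchored_basis : set (set T) :=
  [set A | exists n, anchored n A] `|` [set [set x] | x in isolated [set: T]].

Lemma basis_anchored : (forall n, open_cover (U n)) ->
  limit_point [set: T] `<=` closure (range d) -> basis anchored_basis.
Proof.
move=> ocU dense_d; split=> [A [[n []]//|[x /isolatedT_open ? <-//]]|x O].
rewrite nbhsE => -[P [oP Px] PO].
have [isox|/dense_d clx] := isolated_or_limit_point x.
  exists [set x]; last by move=> _ ->; exact: PO.
  by split=> //; right; exists x.
have [_ [[n _ <-] Pn]] := clx P (open_nbhs_nbhs (conj oP Px)).
have /coversP covU := (ocU n).2.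
have [[C UC Cx] [D UD Dn]] := (covU x, covU (d n)).
exists (P `&` (C `|` D)); last by move=> y [/PO].
split; last by split=> //; left.
left; exists n; split; [|by split=> //; right|].
  by apply: openI => //; apply: openU; exact: (ocU n).1.
exists [set C; D]; split=> [E [->|->]//||y [_ [Cy|Dy]]].
- exact: finite_set2.
- by exists C => //; left.
- by exists D => //; right.
Qed.

Lemma point_finite_anchored_selection (V : set (set T)) : point_finite V ->
  exists2 F, finite_selection U F &
    forall n A, V A -> anchored n A -> A `<=` \bigcup_(C in F n) C.
Proof.
move=> pfV.
have /choice[F FP] n : finitely_covered (U n)
    (\bigcup_(A in [set A | V A /\ anchored n A]) A).
  apply: finitely_covered_bigcup => [|A [_ []]//].
  by apply: sub_finite_set (pfV (d n)) => A [VA []].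
exists F => [n|n A VA ancA]; first by have [] := FP n.
by have [_ _] := FP n; apply: subset_trans => x Ax; exists A.
Qed.

End anchored_basis.

Theorem totally_metacompact_menger (T : topologicalType) (d : nat -> T) :
  limit_point [set: T] `<=` closure (range d) ->
  lindelof T -> totally_metacompact T -> menger T.
Proof.
move=> dense_d linT tmT U ocU.
have [V [VB pfV /coversP covV]] := tmT _ (basis_anchored ocU dense_d).
have [F selF coverF] := point_finite_anchored_selection d U pfV.
apply: (finite_selection_extend linT ocU selF) => x missed_x.
have [A VA Ax] := covV x; have [[n ancA]|[y isoy yA]] := VB A VA.
  by case: missed_x; exists n => //; exact: coverF ancA _ Ax.
by move: Ax; rewrite -yA => ->.
Qed.

Local Open Scope ring_scope.

Section locally_convex.
Context {R : realDomainType} {T : topologicalType}.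
Implicit Types (v : T -> R) (I : set T).

Definition convex_along v I :=
  forall a b c, I a -> I b -> v a <= v c <= v b -> I c.

Definition locally_convex v := forall x O, nbhs x O ->
  exists I, [/\ open I, I x, I `<=` O & convex_along v I].

Lemma convex_alongN v I : convex_along v I -> convex_along (fun x => - v x) I.
Proof. by move=> cI a b c Ia Ib; rewrite !lerN2 andbC; exact: cI. Qed.

Lemma locally_convexN v : locally_convex v -> locally_convex (fun x => - v x).
Proof.
move=> lcv x O /lcv[I [oI Ix IO cI]].
by exists I; split=> //; exact: convex_alongN.
Qed.

Hypothesis hausdorffT : hausdorff_space T.

Lemma open_ray_lt v y : locally_convex v -> open [set z | v z < v y].
Proof.
move=> lcv; rewrite openE => z /= zy.
have zNy : z != y by apply: contraTneq zy => ->; rewrite ltxx.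
move: hausdorffT; rewrite open_hausdorff => /(_ z y zNy).
move=> [[A B] /= [/set_mem Az /set_mem By] [oA _ /eqP AB]].
have [I [oI Iz IA cI]] := lcv z A (open_nbhs_nbhs (conj oA Az)).
rewrite /interior nbhsE; exists I => // t It /=.
rewrite ltNge; apply/negP => yt.
have : (A `&` B) y by split=> //; apply/IA/(cI z t) => //; rewrite (ltW zy).
by rewrite AB.
Qed.

Lemma open_ray_gt v y : locally_convex v -> open [set z | v y < v z].
Proof.
move=> /locally_convexN/(@open_ray_lt _ y).
by under eq_set do rewrite ltrN2.
Qed.

Lemma closed_ray_le v y : locally_convex v -> closed [set z | v z <= v y].
Proof.
move=> /(@open_ray_gt _ y)/open_closedC; congr closed.
by apply/seteqP; split=> z /=; rewrite leNgt => /negP.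
Qed.

Lemma exists_nbhs_closure_right v I x : injective v -> locally_convex v ->
  open I -> I x -> convex_along v I ->
  exists2 N, nbhs x N & forall y, closure N y -> v x <= v y -> I y.
Proof.
move=> injv lcv oI Ix cI.
have closure_ray y : closure [set z | v z <= v y] = [set z | v z <= v y].
  exact/esym/closure_id/closed_ray_le.
have [nx|nx] := pselect (nbhs x [set z | v z <= v x]).
  exists [set z | v z <= v x] => // y.
  rewrite closure_ray => /= yx xy.
  by suff -> : y = x by []; apply/injv/le_anti; rewrite yx.
have exists_right P : open P -> P x -> exists2 y, P y & v x < v y.
  move=> oP Px; apply: contrapT => noy; apply: nx; rewrite nbhsE.
  exists P => // y Py /=; rewrite leNgt; apply/negP => xy.
  by apply: noy; exists y.
have [y Iy xy] := exists_right I oI Ix.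
have [z zy xz] := exists_right _ (open_ray_lt y lcv) xy.
exists [set t | v t < v z].
  by apply: open_nbhs_nbhs; split=> //; exact: open_ray_lt.
move=> t clt xt; have : closure [set u | v u <= v z] t.
  by apply: closureS clt => u; exact: ltW.
rewrite closure_ray => /= tz; apply: (cI x y) => //.
by rewrite xt (le_trans tz) ?ltW.
Qed.

Lemma locally_convex_regular v : injective v -> locally_convex v ->
  regular_space T.
Proof.
move=> injv lcv x A /lcv[I [oI Ix IA cI]].
have [N nN NI] := exists_nbhs_closure_right injv lcv oI Ix cI.
have [|||M nM MI] := @exists_nbhs_closure_right (fun z => - v z) I x _ _ oI Ix.
- by move=> y z /oppr_inj/injv.
- exact: locally_convexN.
- exact: convex_alongN.
exists (N `&` M); first exact: filterI.
move=> y /closureI[Ny My]; apply: IA.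
have [xy|yx] := leP (v x) (v y); first exact: NI.
by apply: MI => //; rewrite lerN2 ltW.
Qed.

Lemma limit_point_between_right v I x y : injective v -> locally_convex v ->
  limit_point [set: T] x -> open I -> I x -> I y -> v x < v y ->
  exists a b c, [/\ I a, I c & v a < v b < v c].
Proof.
move=> injv lcv limx oI Ix Iy xy.
have [|z [zNx _ [Iz zy]]] := limx (I `&` [set z | v z < v y]).
  by apply: open_nbhs_nbhs; split=> //; apply: openI => //; exact: open_ray_lt.
have [xz|zx|/injv/esym/eqP] := ltgtP (v x) (v z); last by rewrite (negbTE zNx).
- by exists x, z, y; rewrite xz.
- by exists z, x, y; rewrite zx.
Qed.

Lemma limit_point_between v I x : injective v -> locally_convex v ->
  limit_point [set: T] x -> open I -> I x ->
  exists a b c, [/\ I a, I c & v a < v b < v c].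
Proof.
move=> injv lcv limx oI Ix.
have [y [yNx _ Iy]] := limx I (open_nbhs_nbhs (conj oI Ix)).
have [xy|yx|/injv/esym/eqP] := ltgtP (v x) (v y); last by rewrite (negbTE yNx).
  exact: limit_point_between_right xy.
have injNv : injective (fun z => - v z) by move=> a b /oppr_inj/injv.
have [|c [b [a [Ic Ia]]]] :=
  limit_point_between_right injNv (locally_convexN lcv) limx oI Ix Iy.
  by rewrite ltrN2.
by rewrite !ltrN2 andbC => abc; exists a, b, c.
Qed.

End locally_convex.

Section rational_selection.
Context {R : archiRealFieldType}.

Lemma exists_seq_between (T : Type) (v : T -> R) (x0 : T) :
  exists d : nat -> T, forall a b c, v a < v b < v c ->
    exists n, v a < v (d n) < v c.
Proof.
have /choice[f fP] (q : rat * rat) : exists t, forall t',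
    ratr q.1 < v t' < ratr q.2 -> ratr q.1 < v t < ratr q.2.
  have [[t' qt']|nq] := pselect (exists t', ratr q.1 < v t' < ratr q.2).
    by exists t'.
  by exists x0 => t' qt'; case: nq; exists t'.
exists (fun n => oapp f x0 (unpickle n)) => a b c /andP[].
move=> /rat_in_itvoo[q1]; rewrite in_itv/= => /andP[aq1 q1b].
move=> /rat_in_itvoo[q2]; rewrite in_itv/= => /andP[bq2 q2c].
exists (pickle (q1, q2)); rewrite pickleK /=.
have /andP[q1f fq2] : ratr q1 < v (f (q1, q2)) < ratr q2.
  by apply: (fP (q1, q2) b); rewrite /= q1b.
by rewrite (lt_trans aq1 q1f) (lt_trans fq2 q2c).
Qed.

Lemma locally_convex_dense_seq (T : topologicalType) (v : T -> R) (x0 : T) :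
  hausdorff_space T -> injective v -> locally_convex v ->
  exists d : nat -> T, limit_point [set: T] `<=` closure (range d).
Proof.
move=> hausT injv lcv; have [d dP] := exists_seq_between v x0; exists d.
move=> x limx O /lcv[I [oI Ix IO cI]].
have [a [b [c [Ia Ic abc]]]] := limit_point_between hausT injv lcv limx oI Ix.
have [n /andP[adn dnc]] := dP a b c abc.
by exists (d n); split; [exists n|apply/IO/(cI a c) => //; rewrite !ltW].
Qed.

End rational_selection.

Section real_GO_space_theory.
Context {R : realType} {X : set R} {G : set (set X)}.

Definition GO_val (x : GO_type G) : R := val (x : X).

Lemma GO_val_inj : injective GO_val.
Proof. exact: val_inj. Qed.

Lemma GO_locally_convex :
  (forall I, G I -> order_convex I) -> locally_convex GO_val.
Proof.
move=> convG x O; rewrite nbhsE => -[P [[D DG <-] [I DI Ix]] PO].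
exists I; split=> //.
- by exists [set I]; [move=> _ ->; exact: DG|rewrite bigcup_set1].
- by move=> y Iy; apply: PO; exists I.
have [E EG <-] := DG _ DI => a b c Ia Ib acb J EJ.
have /set_mem GJ := EG J EJ.
by apply: (convG J GJ a b c); [exact: Ia|exact: Ib|].
Qed.

End real_GO_space_theory.

Theorem corollary3p2 (R : realType) (X : set R) (G : set (set X)) :
  real_GO_space G -> infinite_set X -> lindelof (GO_type G) ->
  (menger (GO_type G) <-> totally_paracompact (GO_type G)) /\
  (totally_paracompact (GO_type G) <-> totally_metacompact (GO_type G)).
Proof.
move=> [/GO_locally_convex lcG hausG] /infinite_setN0[r Xr] linG.
have regG := locally_convex_regular hausG GO_val_inj lcG.
pose x0 : GO_type G := SigSub (mem_set Xr).
have [d dense_d] := locally_convex_dense_seq x0 hausG GO_val_inj lcG.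
have mp := menger_totally_paracompact regG.
have pm := @totally_paracompact_metacompact (GO_type G).
have mm := totally_metacompact_menger dense_d linG.
by split; split; [exact: mp|move/pm/mm|exact: pm|move/mm/mp].
Qed.
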